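(* For all integers $k \ge 4$ and $n \ge (k-1)(k-2)$ such that $n$ is divisible by $k-1$, we have \[ f_k(n) \le (4k-10)\,2^{\frac{n}{k-1}} - 7(k-2). \]
   Context: Let $[n] = \{1,2,\ldots,n\}$. For integers $n,k \ge 2$, a family $\mathcal{F}$ of subsets of $[n]$ is called $k$-wise intersecting if every (non-empty) collection of at most $k$ members of $\mathcal{F}$ has a non-empty intersection. A family $\mathcal{F}$ of subsets of $[n]$ is called maximal $k$-wise intersecting if it is $k$-wise intersecting and adding to $\mathcal{F}$ any subset of $[n]$ not already in $\mathcal{F}$ yields a family that is not $k$-wise intersecting. Let $f_k(n)$ denote the minimum possible size (number of members) of a maximal $k$-wise intersecting family of subsets of $[n]$. *)

(* Defs.v *)
From mathcomp Require Import all_boot all_order all_algebra.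
Set Implicit Arguments.
Unset Strict Implicit.
Unset Printing Implicit Defensive.

(* The ground set [n] is 'I_n. *)
Definition kwise_intersecting (n k : nat) (F : {set {set 'I_n}}) : bool :=
  [forall G : {set {set 'I_n}},
     [&& G \subset F, G != set0 & #|G| <= k] ==> (\bigcap_(A in G) A != set0)].

Definition maximal_kwise_intersecting (n k : nat) (F : {set {set 'I_n}}) : bool :=
  kwise_intersecting k F &&
  [forall A : {set 'I_n}, (A \notin F) ==> ~~ kwise_intersecting k (A |: F)].

Definition max_kwise_size (k n : nat) : pred nat := fun m =>
  [exists F : {set {set 'I_n}}, maximal_kwise_intersecting k F && (#|F| == m)].

Lemma max_kwise_size_exists (k n : nat) : exists m, max_kwise_size k n m.
Proof.
have kwise0 : kwise_intersecting k (set0 : {set {set 'I_n}}).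
  apply/forallP => G; apply/implyP => /and3P[].
  by rewrite subset0 => /eqP ->; rewrite eqxx.
have [F maxF _] := maxset_exists kwise0.
exists #|F|; apply/existsP; exists F; rewrite eqxx andbT.
apply/andP; split; first exact: maxsetp maxF.
apply/forallP => A; apply/implyP => AF; apply/negP => kAF.
have eqF := maxsetsup maxF kAF (subsetUr _ _).
by move: AF; rewrite -eqF setU11.
Qed.

Definition f (k n : nat) : nat := ex_minn (max_kwise_size_exists k n).

(* Main.v *)
Require Import Defs.
From mathcomp Require Import all_boot all_order all_algebra.
From mathcomp Require Import zify.

Set Implicit Arguments.
Unset Strict Implicit.
Unset Printing Implicit Defensive.

(** Pass to complements: a family is [k]-wise intersecting iff no [k] of the
    complements of its members cover the ground set. If no [k] members of a
    family [C] cover it, then every maximal extension of [C] consists only of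
    sets [B] whose complement is not covered by [k - 1] members of [C], so it
    suffices to find [C] with few such "uncovered" [B].

    Let [r = k - 2], and split the ground set into blocks [W_1], ..., [W_r] and
    a core [T] containing distinct points [p_0], ..., [p_r] and at least one
    more. Then [C] consists of the blocks [W_i], the sets [X + {p_0, p_i}] with
    [X] a proper subset of [W_i], the sets [T - {p_0, s}] with [s] none of the
    [p_i], and the sets [T - {p_0, p_i, p_j}]. An uncovered [B] meets at most
    one block. If it meets [W_i], it is [W_i] or [X + S] with [X] proper in
    [W_i] and [S] inside [{p_0, p_i}]; if [B] lies in [T], then [T - B] is not
    uncovered. This gives at most
    [sum_i (4 * (2 ^ |W_i| - 2) + 1) + 2 ^ (|T| - 1)] sets. *)

(** * From noncovering families to a bound on [f] *)

Lemma leq_card_bigcup (I T : finType) (F : I -> {set T}) :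
  #|\bigcup_i F i| <= \sum_i #|F i|.
Proof.
elim/big_rec2: _ => [|i m A _ leAm]; first by rewrite cards0.
by rewrite (leq_trans (leq_card_setU _ _).1) // leq_add2l.
Qed.

Definition uncovered (V : finType) (k : nat) (C : {set {set V}}) : {set {set V}} :=
  [set B | ~~ [exists H : {set {set V}},
      [&& H \subset C, #|H| <= k & ~: B \subset cover H]]].

(** The complements of [C] extend to a maximal family [F]. If some [A] in [F] were covered by at
    most [k] members of [C], then [A] and their complements would be at most [k.+1] members of [F]
    with empty intersection. *)
Lemma f_le_uncovered (n k : nat) (C : {set {set 'I_n}}) :
  (forall H : {set {set 'I_n}}, H \subset C -> #|H| <= k.+1 -> cover H != setT) ->
  f k.+1 n <= #|uncovered k C|.
Proof.
move=> noncover; pose F0 := [set ~: A | A in C].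
have coverC (G : {set {set 'I_n}}) :
    \bigcap_(A in G) A = ~: cover [set ~: A | A in G].
  rewrite cover_imset setC_bigcup.
  by apply: eq_bigr => A _; rewrite setCK.
have imC (G : {set {set 'I_n}}) : G \subset F0 -> [set ~: A | A in G] \subset C.
  move=> /subsetP GF; apply/subsetP => _ /imsetP[A /GF/imsetP[B BC ->] ->].
  by rewrite setCK.
have kF0 : kwise_intersecting k.+1 F0.
  apply/forallP => G; apply/implyP => /and3P[GF _ leGk].
  rewrite coverC -setCT (inj_eq (@setC_inj _)) noncover ?imC //.
  exact: leq_trans (leq_imset_card _ _) leGk.
have [F maxF F0F] := maxset_exists kF0.
have kF := maxsetp maxF.
have fF : f k.+1 n <= #|F|.
  rewrite /f; case: ex_minnP => m _; apply; apply/existsP; exists F.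
  rewrite eqxx andbT /maximal_kwise_intersecting kF /=.
  apply/forallP => A; apply/implyP => AF; apply/negP => kAF.
  by rewrite -(maxsetsup maxF kAF (subsetUr _ _)) setU11 in AF.
apply: leq_trans fF _; rewrite -(card_imset _ (@setC_inj _)).
apply/subset_leq_card/subsetP => _ /imsetP[A AF ->]; rewrite inE.
apply/existsPn => H; apply/negP => /and3P[HC leHk]; rewrite setCK => AH.
move/forallP/(_ (A |: [set ~: B | B in H])): kF => /implyP; case/(_ _)/set0Pn.
  apply/and3P; split.
  - rewrite subUset sub1set AF /=; apply: subset_trans F0F.
    exact: imsetS.
  - by apply/set0Pn; exists A; rewrite setU11.
  - rewrite (leq_trans (leq_card_setU _ _).1) // cards1 ltnS.
    exact: leq_trans (leq_imset_card _ _) leHk.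
move=> x /bigcapP xI; have xA : x \in A by apply: xI; rewrite setU11.
have /bigcupP[B BH xB] := subsetP AH x xA.
by have := xI (~: B); rewrite inE imset_f // orbT inE xB => /(_ isT).
Qed.

(** * The generating family and the shapes of its members *)

Section Construction.

Variables (V : finType) (r : nat) (blk : V -> option 'I_r).
Variables (p0 u : V) (p : 'I_r -> V).

Definition block (i : 'I_r) : {set V} := [set x | blk x == Some i].
Definition core : {set V} := [set x | blk x == None].

Definition generators : {set {set V}} :=
  [set block i | i : 'I_r]
  :|: [set X :|: [set p0; p i] | i in 'I_r, X in [set X : {set V} | X \proper block i]]
  :|: [set core :\: [set p0; s] | s in [set s in core | (s != p0) && [forall i, s != p i]]]
  :|: [set core :\: [set p0; p i; p j] | i in 'I_r, j in [set~ i]].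

Hypothesis r_gt1 : 1 < r.
Hypothesis p0_core : blk p0 = None.
Hypothesis p_core : forall i, blk (p i) = None.
Hypothesis u_core : blk u = None.
Hypothesis p_inj : injective p.
Hypothesis p_neq0 : forall i, p i != p0.
Hypothesis u_neq0 : u != p0.
Hypothesis u_neqp : forall i, u != p i.
Hypothesis block_neq0 : forall i, exists x, blk x = Some i.

Variant generator_spec (h : {set V}) : Prop :=
  | GenBlock i of h = block i
  | GenPiece i (X : {set V}) of X \proper block i & h = X :|: [set p0; p i]
  | GenCore1 s of blk s = None & s != p0 & (forall i, s != p i)
      & h = core :\: [set p0; s]
  | GenCore2 i j of i != j & h = core :\: [set p0; p i; p j].

Lemma generatorP h : reflect (generator_spec h) (h \in generators).
Proof.
apply: (iffP idP).
  rewrite !inE => /orP[/orP[/orP[]|]|].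
  - by case/imsetP => i _ ->; exact: (GenBlock (i := i)).
  - by case/imset2P => i X _; rewrite inE => XW ->; exact: (GenPiece XW).
  - case/imsetP => s; rewrite !inE => /and3P[/eqP sT s0 /forallP sp] ->.
    exact: (GenCore1 sT s0 sp).
  - case/imset2P => i j _; rewrite !inE eq_sym => ij ->.
    exact: (GenCore2 ij).
case=> [i ->|i X XW ->|s sT s0 sp ->|i j ij ->]; rewrite !inE -!orbA.
- by rewrite imset_f.
- by apply/or4P/Or42/imset2P; exists i X; rewrite ?inE.
- apply/or4P/Or43/imset_f; rewrite !inE sT s0 eqxx /=; exact/forallP.
- by apply/or4P/Or44/imset2P; exists i j; rewrite ?inE // eq_sym.
Qed.

(** Blocks and pieces avoid [u], so [h] is of one of the two core types. The point [s] is the one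
    removed along with [p0], or whichever of the two removed [p]-points differs from [p j]. *)
Lemma generator_u h : h \in generators -> u \in h ->
  [/\ forall x, x \in h -> blk x = None, p0 \notin h &
      forall j, exists s, [/\ blk s = None, s != p0, s != p j & s \notin h]].
Proof.
case/generatorP => [i ->|i X /proper_sub/subsetP XW ->|s sT s0 sp ->|i l il ->].
- by rewrite inE u_core.
- rewrite !inE (negPf u_neq0) (negPf (u_neqp i)) !orbF => /XW.
  by rewrite inE u_core.
- move=> _; split=> [x||j]; first by rewrite !inE => /andP[_ /eqP].
    by rewrite !inE eqxx.
  by exists s; split; rewrite // !inE eqxx orbT.
- move=> _; split=> [x||j]; first by rewrite !inE => /andP[_ /eqP].
    by rewrite !inE eqxx.
  have [<-|ij] := eqVneq i j.
    by exists (p l); rewrite p_core p_neq0 (inj_eq p_inj) eq_sym !inE eqxx !orbT.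
  by exists (p i); rewrite p_core p_neq0 (inj_eq p_inj) !inE eqxx !orbT.
Qed.

(** Only the pieces contain [p0], and a piece of [block j] meets the core in [p0] and [p j]
    alone. *)
Lemma generator_p0 h : h \in generators -> p0 \in h ->
  exists j, forall x, x \in h -> blk x = None -> x = p0 \/ x = p j.
Proof.
case/generatorP => [i ->|i X /proper_sub/subsetP XW ->|s sT s0 sp ->|i l il ->].
- by rewrite inE p0_core.
- move=> _; exists i => x; rewrite !inE => /orP[/XW|/orP[]/eqP ->]; try by [left|right].
  by rewrite inE => /eqP ->.
- by rewrite !inE eqxx.
- by rewrite !inE eqxx.
Qed.

Lemma generator_block h i x : h \in generators -> x \in h -> blk x = Some i ->
  h = block i \/ exists2 X : {set V}, X \proper block i & h = X :|: [set p0; p i].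
Proof.
case/generatorP => [j ->|j X XW ->|s sT s0 sp ->|j l il ->].
- by rewrite inE => /eqP -> [->]; left.
- rewrite !inE => /orP[xX xi|/orP[]/eqP ->]; rewrite ?p0_core ?p_core //.
  move/proper_sub/subsetP/(_ x xX): (XW); rewrite inE xi => /eqP[ij].
  by right; exists X; rewrite ?ij.
- by rewrite !inE => /andP[_ /eqP ->].
- by rewrite !inE => /andP[_ /eqP ->].
Qed.

(** * No [r.+2] generators cover the ground set *)

(** The core forces three members of a cover: one for [u], one for [p0], and one for a point that
    these two miss. Each of the [r] blocks forces a further one, which makes at least [r.+3]. *)
Lemma generators_noncover (H : {set {set V}}) :
  H \subset generators -> #|H| <= r.+2 -> cover H != setT.
Proof.
move=> /subsetP HC leH; apply/eqP => coverH.
have cov x : exists2 h, h \in H & x \in h.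
  by apply/bigcupP; rewrite -/(cover H) coverH inE.
have [Q QH uQ] := cov u; have [QT p0Q Qmiss] := generator_u (HC _ QH) uQ.
have [h0 h0H p0h0] := cov p0; have [j h0j] := generator_p0 (HC _ h0H) p0h0.
have [s [sT s0 sj sQ]] := Qmiss j; have [h1 h1H sh1] := cov s.
have sh0 : s \notin h0.
  by apply/negP => /h0j/(_ sT)[] E; [case/eqP: s0|case/eqP: sj].
(* Q, h0, h1 are three members besides one member chosen for each block. *)
have pick_block i : exists h, [/\ h \in H, h != h0, h != h1 & exists2 x, x \in h & blk x = Some i].
  have [x xi] := block_neq0 i; have [h hH xh] := cov x.
  have [/norP[hh0 hh1]|] := boolP (~~ ((h == h0) || (h == h1))).
    by exists h; split => //; exists x.
  rewrite negbK => hh; have [hW|[X XW hX]] := generator_block (HC _ hH) xh xi.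
    case/orP: hh => /eqP hE; rewrite hE in hW.
      by move: p0h0; rewrite hW inE p0_core.
    by move: sh1; rewrite hW inE sT.
  (* Now [h] is [h0] or [h1] and is a piece, hence misses some [y] of the block; the member covering
     [y] is taken in its place. *)
  case/properP: (XW) => _ [y]; rewrite inE => /eqP yi yX.
  have yh : y \notin h.
    rewrite hX !inE (negPf yX) /=; apply/norP; split; apply/eqP => yE.
      by rewrite yE p0_core in yi.
    by rewrite yE p_core in yi.
  have [h' h'H yh'] := cov y.
  have trace (g Y : {set V}) : Y \proper block i -> g = Y :|: [set p0; p i] ->
      (s \in g) = (s == p i).
    move=> /proper_sub/subsetP YW ->; rewrite !inE (negPf s0) /=.
    by case: (boolP (s \in Y)) => // /YW; rewrite inE sT.
  have [h'W|[Y YW h'Y]] := generator_block (HC _ h'H) yh' yi.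
    exists h'; split=> //; last by exists y.
      by apply/eqP => E; move: p0h0; rewrite -E h'W inE p0_core.
    by apply/eqP => E; move: sh1; rewrite -E h'W inE sT.
  (* Pieces of the same block have the same trace on the core. As [s] lies in [h1] but not in [h0],
     agreement on [s] keeps [h'] from being the other one of the two, and [y] separates it from
     [h]. *)
  have hh' : (s \in h) = (s \in h') by rewrite (trace _ _ XW hX) (trace _ _ YW h'Y).
  exists h'; split=> //; last by exists y.
    apply/eqP => E; case/orP: hh => /eqP hE.
      by rewrite hE -E yh' in yh.
    by rewrite hE E sh1 (negPf sh0) in hh'.
  apply/eqP => E; case/orP: hh => /eqP hE.
    by rewrite hE E sh1 (negPf sh0) in hh'.
  by rewrite hE -E yh' in yh.
have [g gP] := fin_all_exists pick_block.
(* A generator meets at most one block. *)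
have g_inj : injective g.
  move=> i i' gi; have [_ _ _ [x xg xi]] := gP i; have [_ _ _ [y yg yi]] := gP i'.
  have [gW|[X XW gX]] := generator_block (HC _ (let: And4 a _ _ _ := gP i in a)) xg xi.
    by move: yg; rewrite -gi gW inE yi => /eqP[].
  move: yg; rewrite -gi gX !inE => /orP[|/orP[]/eqP E].
  - by move/(subsetP (proper_sub XW)); rewrite inE yi => /eqP[].
  - by rewrite E p0_core in yi.
  - by rewrite E p_core in yi.
suff: #|Q |: (h0 |: (h1 |: [set g i | i : 'I_r]))| <= #|H|.
  have -> : #|Q |: (h0 |: (h1 |: [set g i | i : 'I_r]))| = r.+3.
    have gn h : (forall i, g i != h) -> h \notin [set g i | i : 'I_r].
      by move=> gh; apply/imsetP => -[i _ E]; have := gh i; rewrite E eqxx.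
    have Qg : Q \notin [set g i | i : 'I_r].
      apply: gn => i; have [_ _ _ [x xg xi]] := gP i; apply/eqP => E.
      by move: xg; rewrite E => /QT; rewrite xi.
    have h0g : h0 \notin [set g i | i : 'I_r] by apply: gn => i; case: (gP i).
    have h1g : h1 \notin [set g i | i : 'I_r] by apply: gn => i; case: (gP i).
    have Qh0 : Q != h0 by apply: contraNneq p0Q => ->.
    have Qh1 : Q != h1 by apply: contraNneq sQ => ->.
    have h01 : h0 != h1 by apply: contraNneq sh0 => ->.
    rewrite !cardsU1 card_imset // card_ord !inE (negPf Qh0) (negPf Qh1) (negPf h01).
    by rewrite (negPf Qg) (negPf h0g) (negPf h1g).
  by move=> /leq_trans/(_ leH); rewrite ltnn.
apply/subset_leq_card; rewrite !subUset !sub1set QH h0H h1H /=.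
by apply/subsetP => _ /imsetP[i _ ->]; case: (gP i).
Qed.

(** * The shape of uncovered sets *)

Lemma uncovered_generatorsN (B : {set V}) (g : 'I_r -> {set V}) (Q : {set V}) :
  (forall i, g i \in generators) -> Q \in generators ->
  (forall x, x \notin B -> x \in Q \/ exists i, x \in g i) ->
  B \notin uncovered r.+1 generators.
Proof.
move=> gC QC BP; rewrite inE negbK; apply/existsP.
exists (Q |: [set g i | i : 'I_r]); apply/and3P; split.
- rewrite subUset sub1set QC; apply/subsetP => _ /imsetP[i _ ->]; exact: gC.
- rewrite (leq_trans (leq_card_setU _ _).1) // cards1 ltnS.
  by rewrite (leq_trans (leq_imset_card _ _)) // card_ord.
apply/subsetP => x; rewrite inE => /BP[xQ|[i xi]]; apply/bigcupP.
  by exists Q; rewrite // setU11.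
by exists (g i); rewrite // inE imset_f // orbT.
Qed.


(** One generator per block covers all blocks outside [B]: the whole block if [B] misses it, and
    otherwise the piece with [X = block i :\: B], which is proper and brings [p0] and [p i] along.
    The single remaining [Q] has to cover the rest of the core. *)
Lemma uncovered_hit (B Q : {set V}) : Q \in generators ->
  (forall x, x \notin B -> blk x = None ->
     x \in Q \/ exists y i, [/\ y \in B, blk y = Some i & x \in [set p0; p i]]) ->
  B \notin uncovered r.+1 generators.
Proof.
move=> QC BP; pose hit i := [exists y in B, blk y == Some i].
pose g i := if hit i then (block i :\: B) :|: [set p0; p i] else block i.
apply: (@uncovered_generatorsN _ g Q) => // [i|x xB].
  rewrite /g; case: ifP => [/exists_inP[y yB yi]|_]; apply/generatorP.
    apply: (@GenPiece _ i (block i :\: B)) => //.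
    by apply/properP; split; [exact: subsetDl|exists y; rewrite !inE ?yB].
  exact: (@GenBlock _ i).
case xi: (blk x) => [i|].
  by right; exists i; rewrite /g; case: ifP => _; rewrite !inE xi ?xB eqxx.
have [xQ|[y [i [yB yi xp]]]] := BP x xB xi; [by left|right; exists i].
rewrite /g ifT; last by apply/exists_inP; exists y; rewrite ?yi.
by rewrite inE xp orbT.
Qed.

(** As [block i] needs no cover, its slot is free for a second generator [h] on the core. *)
Lemma uncovered_full (B Q h : {set V}) (i : 'I_r) :
  block i \subset B -> Q \in generators -> h \in generators ->
  (forall x, x \notin B -> blk x = None -> x \in Q \/ x \in h) ->
  B \notin uncovered r.+1 generators.
Proof.
move=> /subsetP iB QC hC BP.
apply: (@uncovered_generatorsN _ (fun l => if l == i then h else block l) Q) => //.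
  by move=> l; case: ifP => // _; apply/generatorP; exact: (@GenBlock _ l).
move=> x xB; case xl: (blk x) => [l|].
  right; exists l; case: eqP => [E|_]; last by rewrite inE xl.
  by have := iB x; rewrite inE xl E eqxx (negPf xB) => /(_ isT).
by have [|] := BP x xB xl; [left|right; exists i; rewrite eqxx].
Qed.

Lemma core2_generator i j : i != j -> core :\: [set p0; p i; p j] \in generators.
Proof. by move=> ij; apply/generatorP; exact: (GenCore2 ij). Qed.

Lemma core1_generator s : blk s = None -> s != p0 -> (forall i, s != p i) ->
  core :\: [set p0; s] \in generators.
Proof. by move=> sT s0 sp; apply/generatorP; exact: (@GenCore1 _ s). Qed.

Lemma pair_generator i : [set p0; p i] \in generators.
Proof.
apply/generatorP; apply: (@GenPiece _ i set0); last by rewrite set0U.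
by rewrite proper0; have [x xi] := block_neq0 i; apply/set0Pn; exists x; rewrite inE xi.
Qed.

(** Pieces of two different hit blocks would supply [p0], [p i] and [p j], exactly the points
    missing from one generator of the core. *)
Lemma uncovered_one_block B x y i j : B \in uncovered r.+1 generators ->
  x \in B -> y \in B -> blk x = Some i -> blk y = Some j -> i = j.
Proof.
move=> BU xB yB xi yj; apply: contraTeq BU => ij.
apply: (uncovered_hit (core2_generator ij)) => z _ zT; rewrite !inE zT.
have [->|z0] := eqVneq z p0; first by right; exists x, i; rewrite !inE eqxx.
have [->|zi] := eqVneq z (p i); first by right; exists x, i; rewrite !inE eqxx orbT.
have [->|zj] := eqVneq z (p j); first by right; exists y, j; rewrite !inE eqxx orbT.
by left.
Qed.

(** The piece of [block i] supplies [p0] and [p i], and [s] itself lies in [B]. So if [s] were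
    another core point, a core generator missing only [s] and some of these two would complete a
    cover. *)
Lemma uncovered_core_trace B x i s : B \in uncovered r.+1 generators ->
  x \in B -> blk x = Some i -> s \in B -> blk s = None -> s \in [set p0; p i].
Proof.
move=> BU xB xi sB sT; apply: contraTT BU; rewrite in_set2 => /norP[s0 si].
have hit z : z \in [set p0; p i] -> exists y l,
    [/\ y \in B, blk y = Some l & z \in [set p0; p l]] by exists x, i.
have [/existsP[j /eqP sj]|] := boolP [exists j, s == p j].
  have ij : i != j by apply: contraNneq si => ->; rewrite sj.
  apply: (uncovered_hit (core2_generator ij)) => z zB zT.
  have [/hit|] := boolP (z \in [set p0; p i]); first by right.
  rewrite !inE zT => /norP[/negPf -> /negPf ->]; left; rewrite andbT /=.
  by apply: contraNneq zB => ->; rewrite -sj.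
rewrite negb_exists => /forallP sp.
apply: (uncovered_hit (core1_generator sT s0 sp)) => z zB zT.
have [->|z0] := eqVneq z p0; first by right; apply: hit; rewrite !inE eqxx.
left; rewrite !inE zT (negPf z0) andbT /=.
by apply: contraNneq zB => ->.
Qed.

Lemma uncovered_full_block B i : B \in uncovered r.+1 generators ->
  block i \subset B -> B = block i.
Proof.
move=> BU iB; have [x xi] := block_neq0 i.
have xB : x \in B by apply: (subsetP iB); rewrite inE xi.
apply/eqP; rewrite eqEsubset iB andbT; apply/subsetP => y yB; rewrite inE.
case yj: (blk y) => [j|]; first by rewrite (uncovered_one_block BU yB xB yj xi).
have := uncovered_core_trace BU xB xi yB yj; rewrite !inE => yp.
suff: B \notin uncovered r.+1 generators by rewrite BU.
(* A second index exists because [1 < r]. *)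
have [j ij] : exists j : 'I_r, i != j.
  have [E|E] := eqVneq i (Ordinal r_gt1); last by exists (Ordinal r_gt1).
  by exists (Ordinal (ltnW r_gt1)); rewrite E -val_eqE.
(* Two generators cover the core except [y]: the one without [p0], [p i], [p j] is completed by the
   one without [p0] and [u] if [y = p0], and by the pair of [p0] and [p j] if [y = p i]. *)
case/orP: yp => /eqP yE.
  apply: (uncovered_full iB (core2_generator ij) (core1_generator u_core u_neq0 u_neqp)).
  move=> z zB zT; rewrite !inE zT.
  have -> /= : (z == p0) = false by apply: contraNF zB => /eqP ->; rewrite -yE.
  rewrite !andbT; have [->|] := eqVneq z u; last by right.
  by left; rewrite negb_or !u_neqp.
apply: (uncovered_full iB (core2_generator ij) (pair_generator j)).
move=> z zB zT; rewrite !inE zT.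
have -> /= : (z == p i) = false by apply: contraNF zB => /eqP ->; rewrite -yE.
rewrite orbF andbT; case: ((z == p0) || (z == p j)); by [right|left].
Qed.

(** By symmetry [p0] lies in [S]. Either [S] lies inside a pair [[set p0; p i]], a generator that
    then covers what [core :\: S] leaves of the core, or [S] contains [p0] and enough further points
    to contain the complement in the core of a core generator. *)
Lemma uncovered_coreC (S : {set V}) : S \subset core ->
  S \in uncovered r.+1 generators -> core :\: S \notin uncovered r.+1 generators.
Proof.
wlog p0S : S / p0 \in S => [wlogS|] ST SU.
  have [/wlogS->//|p0S] := boolP (p0 \in S).
  apply: contraTN SU => DU.
  rewrite -[S](_ : core :\: (core :\: S) = S); last first.
    by rewrite setDDr setDv set0U; apply/setIidPr.
  by apply: wlogS => //; rewrite ?subsetDl // !inE p0S p0_core.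
have [/existsP[i Si]|/existsPn Sp] := boolP [exists i, S \subset [set p0; p i]].
  apply: (uncovered_hit (pair_generator i)) => x; rewrite in_setD negb_and negbK => xDS xT.
  by left; apply: (subsetP Si); move: xDS; rewrite inE xT eqxx orbF.
suff: S \notin uncovered r.+1 generators by rewrite SU.
have coverS Q : Q \in generators -> (forall x, blk x = None -> x \notin Q -> x \in S) ->
    S \notin uncovered r.+1 generators.
  move=> QC QS; apply: (uncovered_hit QC) => x xS xT; left.
  by apply: contraNT xS; exact: QS.
have inCore M x : blk x = None -> x \notin core :\: M -> x \in M.
  by move=> xT; rewrite !inE xT andbT negbK.
have other i : exists2 s, s \in S & s \notin [set p0; p i] by apply/subsetPn/Sp.
(* The index is arbitrary: any point of [S] besides [p0] will do. *)
have [s sS] := other (Ordinal r_gt1); rewrite in_set2 => /norP[s0 _].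
have sT : blk s = None by have := subsetP ST s sS; rewrite inE => /eqP.
have [/existsP[j /eqP sj]|] := boolP [exists j, s == p j]; last first.
  rewrite negb_exists => /forallP sp; apply: (coverS _ (core1_generator sT s0 sp)).
  by move=> x xT /(inCore _ _ xT); rewrite !inE => /orP[]/eqP ->.
have [t tS] := other j; rewrite in_set2 => /norP[t0 tj].
have tT : blk t = None by have := subsetP ST t tS; rewrite inE => /eqP.
have [/existsP[l /eqP tl]|] := boolP [exists l, t == p l]; last first.
  rewrite negb_exists => /forallP tp; apply: (coverS _ (core1_generator tT t0 tp)).
  by move=> x xT /(inCore _ _ xT); rewrite !inE => /orP[]/eqP ->.
have jl : j != l by apply: contraNneq tj => ->; rewrite tl.
apply: (coverS _ (core2_generator jl)) => x xT /(inCore _ _ xT).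
by rewrite !inE -sj -tl => /orP[/orP[]|]/eqP ->.
Qed.

(** * Counting the uncovered sets *)

(** Complementation in the core maps these sets injectively to sets outside the collection, so they
    are at most half of the subsets of the core. *)
Lemma card_uncovered_core :
  #|uncovered r.+1 generators :&: powerset core| <= 2 ^ #|core|.-1.
Proof.
set C := _ :&: _; pose C' := [set core :\: S | S in C].
have cardC' : #|C'| = #|C|.
  apply: card_in_imset => S S'; rewrite !inE => /andP[_ SC] /andP[_ SC'] E.
  rewrite -(setIidPr SC) -(setIidPr SC') -[LHS]set0U -[RHS]set0U -(setDv core).
  by rewrite -!setDDr E.
have disC : C :&: C' = set0.
  apply/setP => S; rewrite [RHS]inE; apply/negP => /setIP[SC /imsetP[S' S'C SE]].
  case/setIP: SC => SU _; case/setIP: S'C => S'U; rewrite powersetE => S'C.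
  by have := uncovered_coreC S'C S'U; rewrite -SE SU.
have : #|C :|: C'| <= #|powerset core|.
  apply/subset_leq_card/subsetP => S; rewrite inE => /orP[|/imsetP[S' _ ->]].
    by case/setIP.
  by rewrite inE subsetDl.
rewrite card_powerset cardsU disC cards0 subn0 cardC' addnn.
have : 0 < #|core| by apply/card_gt0P; exists p0; rewrite inE p0_core.
by case: #|core| => // t _; rewrite expnS mul2n leq_double.
Qed.

Lemma card_uncovered_generators :
  #|uncovered r.+1 generators| + 7 * r
    <= 4 * \sum_i 2 ^ #|block i| + 2 ^ #|core|.-1.
Proof.
set U := uncovered _ _.
pose D i := [set X :|: S | X in powerset (block i) :\: [set set0; block i],
                           S in powerset [set p0; p i]].
have UD : U \subset (\bigcup_i (block i |: D i)) :|: (U :&: powerset core).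
  apply/subsetP => B BU; rewrite in_setU in_setI BU /=.
  have [BT|/subsetPn[x xB]] := boolP (B \subset core).
    by rewrite powersetE BT orbT.
  rewrite inE; case xi: (blk x) => [i|//] _; apply/orP; left.
  apply/bigcupP; exists i => //; rewrite in_setU1.
  have [iB|iB] := boolP (block i \subset B).
    by rewrite (uncovered_full_block BU iB) eqxx.
  apply/orP; right; apply/imset2P; exists (B :&: block i) (B :&: core).
  - rewrite in_setD powersetE subsetIr andbT !inE; apply/norP; split.
      by apply/set0Pn; exists x; rewrite !inE xB xi eqxx.
    by apply: contraNneq iB => <-; exact: subsetIl.
  - rewrite inE; apply/subsetP => s /setIP[sB]; rewrite inE => /eqP sT.
    exact: (uncovered_core_trace BU xB xi).
  apply/setP => y; rewrite !inE -andb_orr.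
  have [yB|//] := boolP (y \in B); case yj: (blk y) => [j|] //=.
  by rewrite (uncovered_one_block BU yB xB yj xi) eqxx.
(* The 7 is [4 * 2 - 1]: the traces [set0] and [block i] are excluded, each with 4 choices of [S],
   and [block i] itself is added back. *)
have cardD i : #|block i |: D i| + 7 <= 4 * 2 ^ #|block i|.
  have W0 : 0 < #|block i|.
    by have [x xi] := block_neq0 i; apply/card_gt0P; exists x; rewrite inE xi.
  have cP : #|powerset (block i) :\: [set set0; block i]| = 2 ^ #|block i| - 2.
    rewrite cardsD card_powerset (setIidPr _).
      by rewrite cards2 eq_sym -card_gt0 W0.
    by apply/subsetP => X; rewrite !inE => /orP[]/eqP ->; rewrite ?sub0set.
  have leD : #|D i| <= (2 ^ #|block i| - 2) * 4.
    rewrite /D curry_imset2X (leq_trans (leq_imset_card _ _)) // cardsX cP.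
    by rewrite card_powerset cards2 eq_sym p_neq0.
  (* This makes the truncated subtraction [2 ^ #|block i| - 2] exact. *)
  have : 2 ^ 1 <= 2 ^ #|block i| by rewrite leq_exp2l.
  have := (leq_card_setU [set block i] (D i)).1; rewrite cards1.
  move: leD; rewrite expn1; lia.
have leD : #|\bigcup_i (block i |: D i)| + 7 * r <= 4 * \sum_i 2 ^ #|block i|.
  apply: leq_trans (leq_add (leq_card_bigcup _) (leqnn _)) _.
  rewrite big_distrr /= -[r in 7 * r]card_ord mulnC -sum_nat_const -big_split /=.
  by apply: leq_sum => i _; exact: cardD.
apply: leq_trans (leq_add leD card_uncovered_core).
by rewrite addnAC leq_add2r (leq_trans (subset_leq_card UD)) ?leq_card_setU.
Qed.

End Construction.

(** * Choice of the block sizes and the final bound *)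

Lemma card_ord_interval (n a b : nat) : b <= n -> #|[set x : 'I_n | a <= x < b]| = b - a.
Proof.
move=> bn; rewrite -sum1dep_card -[RHS]muln1 -sum_nat_const_nat big_geq_mkord.
by rewrite (big_ord_widen_cond _ (fun i => a <= i) (fun=> 1) bn).
Qed.

(* The core is an initial segment of m + 2 points; the first two blocks have
   m - 1 points and the remaining ones m. *)
Lemma f_upper_bound (r m : nat) : 1 < r -> r <= m ->
  f r.+2 (r.+1 * m) + 7 * r <= (4 * r - 2) * 2 ^ m.
Proof.
move=> r_gt1 rm; set n := r.+1 * m.
have mn : m.+2 < n by rewrite /n; nia.
(* [start i] is the first position of block [i], and [start r = n] closes the last block. *)
pose start i := if i is j.+2 then j.+3 * m else if i is 1 then 2 * m + 1 else m + 2.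
have start_mono i : start i < start i.+1.
  by case: i => [|[|i]]; rewrite /start; nia.
have start_n : start r = n by rewrite /n; case: (r) r_gt1 => [|[]].
have start_le i j : i <= j -> start i <= start j.
  elim: j => [|j IH]; first by rewrite leqn0 => /eqP ->.
  rewrite leq_eqVlt => /predU1P[->//|/IH le]; exact: leq_trans le (ltnW (start_mono j)).
have start0 (i : nat) : m.+2 <= start i by rewrite -addn2; exact: (start_le 0).
pose blk (x : 'I_n) : option 'I_r := [pick i : 'I_r | start i <= x < start i.+1].
have blk_Some (x : 'I_n) i : (blk x == Some i) = (start i <= x < start i.+1).
  rewrite /blk; case: pickP => [j /andP[jx xj]|->//].
  apply/eqP/idP => [[<-]|/andP[ix xi]]; first by rewrite jx.
  congr Some; apply: val_inj; apply/eqP; rewrite eqn_leq.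
  apply/andP; split; rewrite leqNgt; apply/negP => /start_le.
    by rewrite leqNgt (leq_ltn_trans jx xi).
  by rewrite leqNgt (leq_ltn_trans ix xj).
have blk_None (x : 'I_n) : (blk x == None) = (x < m.+2).
  rewrite /blk; case: pickP => [j /andP[jx xj]|nox].
    by apply/esym/negbTE; rewrite -leqNgt (leq_trans (start0 j)).
  rewrite eqxx; apply/esym/negbNE/negP; rewrite -leqNgt -addn2 => x0.
  suff: start r <= x by rewrite start_n leqNgt ltn_ord.
  (* A point beyond the core and in no block would lie past every [start i], up to [start r = n]. *)
  elim: {-2}r (leqnn r) => [//|i IH] ir; rewrite leqNgt; apply/negP => xi.
  by have := nox (Ordinal ir); rewrite /= xi IH // ltnW.
have lt_n i : i < m.+2 -> i < n by move=> im; rewrite (ltn_trans im).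
pose pt i (im : i < m.+2) : 'I_n := Ordinal (lt_n i im).
have pt_core i im : blk (@pt i im) = None by apply/eqP; rewrite blk_None.
(* The special points [p0], [p i], [u] take positions 0, [i.+1] and [r.+1]; they fit into the [m.+2]
   points of the core because [r <= m]. *)
have p_lt (i : 'I_r) : i.+1 < m.+2 by have := ltn_ord i; lia.
pose p (i : 'I_r) := pt _ (p_lt i).
have u_lt : r.+1 < m.+2 by [].
have p_inj : injective p by move=> i j /(congr1 val) [] /val_inj.
have block_lt (i : 'I_r) : start i.+1 <= n by rewrite -start_n start_le.
pose p0 := pt 0 isT; pose u := pt r.+1 u_lt.
have p0_core : blk p0 = None by exact: pt_core.
have p_core i : blk (p i) = None by exact: pt_core.
have u_core : blk u = None by exact: pt_core.
have u_neqp i : u != p i by rewrite -val_eqE /= eqSS gtn_eqF // ltn_ord.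
have block_neq0 i : exists x, blk x = Some i.
  have xn : start i < n by apply: leq_trans (block_lt i).
  by exists (Ordinal xn); apply/eqP; rewrite blk_Some leqnn start_mono.
have le_f : f r.+2 n <= #|uncovered r.+1 (generators blk p0 p)|.
  by apply: f_le_uncovered => H; exact: (@generators_noncover _ _ _ p0 u).
have le_U : #|uncovered r.+1 (generators blk p0 p)| + 7 * r
    <= 4 * \sum_i 2 ^ #|block blk i| + 2 ^ #|core blk|.-1.
  exact: (@card_uncovered_generators _ _ _ p0 u).
apply: leq_trans (leq_add le_f (leqnn _)) (leq_trans le_U _).
have card_block i : #|block blk i| = start i.+1 - start i.
  rewrite -(card_ord_interval _ (block_lt i)); congr #|pred_of_set _|.
  by apply/setP => x; rewrite !inE blk_Some.
have -> : #|core blk| = m.+2.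
  rewrite -[RHS]subn0 -(card_ord_interval 0 (ltnW mn)); congr #|pred_of_set _|.
  by apply/setP => x; rewrite !inE blk_None.
rewrite (eq_bigr (fun i : 'I_r => 2 ^ (start i.+1 - start i))); last first.
  by move=> i _; rewrite card_block.
case: (r) r_gt1 rm => [|[|r']] // _ rm.
rewrite !big_ord_recl /= (eq_bigr (fun=> 2 ^ m)); last first.
  by move=> i _; congr (2 ^ _); rewrite /bump /=; lia.
rewrite sum_nat_const card_ord.
have -> : 2 * m + 1 - (m + 2) = m.-1 by lia.
have -> : 3 * m - (2 * m + 1) = m.-1 by lia.
have -> : 2 ^ m.+2.-1 = 4 * 2 ^ m.-1 by rewrite -(expnD 2 2); congr (2 ^ _); lia.
have -> : 2 ^ m = 2 * 2 ^ m.-1 by rewrite -expnS; congr (2 ^ _); lia.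
(* With [a = 2 ^ m.-1], the two short blocks give [8 * a], the others [8 * (r - 2) * a] and the core
   [4 * a], in total [(8 * r - 4) * a]. *)
nia.
Qed.

Local Open Scope ring_scope.

Theorem theorem1 (k n : nat) (hk : (4 <= k)%N)
    (hn : ((k - 1) * (k - 2) <= n)%N) (hdvd : (k - 1 %| n)%N) :
  (f k n)%:Z <= (4 * k%:Z - 10) * 2 ^+ (n %/ (k - 1))%N - 7 * (k%:Z - 2).
Proof.
case: k hk hn hdvd => [|[|r]] // r_gt1; rewrite !subSS !subn0 => hn /dvdnP[m nE].
(* With [k = r.+2] and [n = m * r.+1], the lower bound on [n] becomes [r <= m], and [4 * k - 10] is
   [4 * r - 2]. *)
move: hn; rewrite {n}nE mulnK // mulnC leq_pmul2r // => rm.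
have := f_upper_bound r_gt1 rm; rewrite mulnC.
have -> : (2 : int) ^+ m = (2 ^ m)%N%:Z by rewrite -natz GRing.natrX.
lia.
Qed.
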